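(* Let $L$ and $f$ be as in the context, and assume that $f$ satisfies (F-1) and (F-2). Then there exists a continuous function $M(x,t)$ on $\mathbb{R}^n\times(0,\infty)$ such that for every $g\in C(\mathbb{R}^n)$ with $g\ge 0$ and every classical solution $u$ of the Cauchy problem (1.1) with initial data $g$, one has $u(x,t)\le M(x,t)$ for all $x\in\mathbb{R}^n$ and all $t>0$.
   Context: Let $L=\sum_{i,j=1}^n a_{ij}(x)\frac{\partial^2}{\partial x_i\partial x_j}+\sum_{i=1}^n b_i(x)\frac{\partial}{\partial x_i}$ with $a_{ij},b_i\in C^{\alpha}(\mathbb{R}^n)$ and $\sum_{i,j}a_{ij}(x)\nu_i\nu_j>0$ for all $x\in\mathbb{R}^n$, $\nu\in\mathbb{R}^n\setminus\{0\}$. Let $f:\mathbb{R}^n\times[0,\infty)\to\mathbb{R}$ be locally Lipschitz in $x$ and in $u$. The Cauchy problem (1.1) with initial data $g\in C(\mathbb{R}^n)$, $g\ge0$, is: $u_t=Lu+f(x,u)$ in $\mathbb{R}^n\times(0,\infty)$, $u(x,0)=g(x)$, $u\ge0$; a (classical) solution is $u\in C^{2,1}(\mathbb{R}^n\times(0,\infty))\cap C(\mathbb{R}^n\times[0,\infty))$ satisfying these. For $R>0$ let $F_R(u)=\sup_{|x|\le R}f(x,u)$. Condition (F-1): $\sup_{u>0}F_R(u)<\infty$ for all $R>0$. Let $\log^{(i)}$ denote the $i$-th iterate of $\log$ ($\log^{(1)}=\log$, $\log^{(2)}=\log\log$, etc.), with $\prod_{i=1}^0\log^{(i)}u=1$.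 Condition (F-2): for each $R>0$ there exist an integer $m\ge0$ and $\epsilon>0$ such that $\lim_{u\to\infty}\frac{F_R(u)}{u\left(\prod_{i=1}^m\log^{(i)}u\right)^2(\log^{(m+1)}u)^{2+\epsilon}}=-\infty$. *)

(* Defs.v *)
From HB Require Import structures.
From mathcomp Require Import all_boot all_order all_algebra.
From mathcomp Require Import all_classical all_reals all_analysis.
Set Implicit Arguments. Unset Strict Implicit. Unset Printing Implicit Defensive.
Import Order.TTheory GRing.Theory Num.Theory.
Import numFieldNormedType.Exports.
Local Open Scope classical_set_scope.
Local Open Scope ring_scope.

Section Defs.
Variable R : realType.
Variable n : nat.
Notation pt := 'rV[R]_n.

Definition enorm (x : pt) : R := Num.sqrt (\sum_(i < n) (x ord0 i) ^+ 2).

Definition evec (i : 'I_n) : pt := delta_mx ord0 i.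

Definition dx (w : pt -> R) (i : 'I_n) (x : pt) : R := 'D_(evec i) w x.

Definition dt (u : pt -> R -> R) (x : pt) (t : R) : R := 'D_1 (fun s => u x s) t.

Definition dxx (u : pt -> R -> R) (i j : 'I_n) (x : pt) (t : R) : R :=
  dx (dx (fun y => u y t) j) i x.

Definition locally_holder (alpha : R) (a : pt -> R) : Prop :=
  forall r : R, 0 < r -> exists C : R, forall x y : pt,
    enorm x <= r -> enorm y <= r -> `|a x - a y| <= C * powR (enorm (x - y)) alpha.

Definition elliptic (a : 'I_n -> 'I_n -> pt -> R) : Prop :=
  forall (x : pt) (nu : pt), nu != 0 ->
    0 < \sum_(i < n) \sum_(j < n) a i j x * nu ord0 i * nu ord0 j.

Definition locally_lipschitz (f : pt -> R -> R) : Prop :=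
  forall r : R, 0 < r -> exists K : R, forall (x y : pt) (u v : R),
    enorm x <= r -> enorm y <= r -> 0 <= u <= r -> 0 <= v <= r ->
    `|f x u - f y v| <= K * (enorm (x - y) + `|u - v|).

Definition FR (f : pt -> R -> R) (r u : R) : R :=
  sup [set f x u | x in [set x : pt | enorm x <= r]].

Definition cond_F1 (f : pt -> R -> R) : Prop :=
  forall r : R, 0 < r -> exists C : R, forall u : R, 0 < u -> FR f r u <= C.

Definition logit (i : nat) (u : R) : R := iter i (@ln R) u.

Definition cond_F2 (f : pt -> R -> R) : Prop :=
  forall r : R, 0 < r -> exists (m : nat) (eps : R), 0 < eps /\
    (fun u : R => FR f r u /
       (u * (\prod_(1 <= i < m.+1) logit i u) ^+ 2 * powR (logit m.+1 u) (2 + eps)))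
      @ +oo --> -oo.

Definition C21 (u : pt -> R -> R) : Prop :=
  (forall (x : pt) (t : R), 0 < t ->
     derivable (fun s => u x s) t 1 /\
     forall i : 'I_n, derivable (fun y => u y t) x (evec i) /\
       forall j : 'I_n, derivable (dx (fun y => u y t) j) x (evec i)) /\
  {within [set p : pt * R | 0 < p.2], continuous (fun p => dt u p.1 p.2)} /\
  (forall i : 'I_n,
     {within [set p : pt * R | 0 < p.2], continuous (fun p => dx (fun y => u y p.2) i p.1)}) /\
  (forall i j : 'I_n,
     {within [set p : pt * R | 0 < p.2], continuous (fun p => dxx u i j p.1 p.2)}).

Definition Lop (a : 'I_n -> 'I_n -> pt -> R) (b : 'I_n -> pt -> R)
  (u : pt -> R -> R) (x : pt) (t : R) : R :=
  \sum_(i < n) \sum_(j < n) a i j x * dxx u i j x t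
  + \sum_(i < n) b i x * dx (fun y => u y t) i x.

Definition is_solution (a : 'I_n -> 'I_n -> pt -> R) (b : 'I_n -> pt -> R)
  (f : pt -> R -> R) (g : pt -> R) (u : pt -> R -> R) : Prop :=
  C21 u /\
  {within [set p : pt * R | 0 <= p.2], continuous (fun p => u p.1 p.2)} /\
  (forall (x : pt) (t : R), 0 < t -> dt u x t = Lop a b u x t + f x (u x t)) /\
  (forall x : pt, u x 0 = g x) /\
  (forall (x : pt) (t : R), 0 <= t -> 0 <= u x t).

End Defs.

(* Main.v *)
Require Import Defs.
From HB Require Import structures.
From mathcomp Require Import all_boot all_order all_algebra.
From mathcomp Require Import all_classical all_reals all_analysis.
From mathcomp Require Import ring lra.
Set Implicit Arguments. Unset Strict Implicit. Unset Printing Implicit Defensive.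
Import Order.TTheory GRing.Theory Num.Theory.
Import numFieldNormedType.Exports.
Local Open Scope classical_set_scope.
Local Open Scope ring_scope.

(** On the ball [|x| < r] every solution lies below the barrier [Phi (z (x, t))],
    where [z = delta (1 - |x|^2/r^2) (1 - exp (-t))] vanishes on the parabolic
    boundary and [Phi z = exp^(m+1) (z^-k)] with [k eps >= 2]. This [Phi] is chosen
    so that [Phi'] and [Phi''] are both at most a constant times [h (Phi)], where
    [h u = u (prod_(i <= m) log^(i) u)^2 (log^(m+1) u)^(2+eps)]. At a positive
    maximum of [u - Phi (z)] the first and second order conditions and the equation
    give [f (x, u) >= - K h (Phi (z))], while (F-2) and the monotonicity of [h] give
    [f (x, u) < - K h (u) <= - K h (Phi (z))] once [delta] is small. The barriers for
    [r = 1, 2, ...] bound all solutions locally, and a continuous majorant of these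
    bounds is the required function. *)

(** * Traces of products of semidefinite forms *)

Definition qform (R : realFieldType) (n : nat) (S : 'I_n -> 'I_n -> R)
  (v : 'I_n -> R) : R := \sum_(i < n) \sum_(j < n) S i j * v i * v j.

(** Only coordinate [k] of the vector moves. When the form is semidefinite, the right side is a
    quadratic polynomial in [c] that never becomes negative, and well-chosen values of [c] then
    constrain row [k]. *)
Lemma qform_shift (R : realFieldType) (n : nat) (S : 'I_n -> 'I_n -> R)
    (v : 'I_n -> R) (k : 'I_n) (c : R) :
  (forall i j, S i j = S j i) ->
  qform S (fun i => v i + c * (i == k)%:R) =
  qform S v + c * 2 * (\sum_j S k j * v j) + c ^+ 2 * S k k.
Proof.
move=> symS.
have pick (F : 'I_n -> R) : \sum_i F i * (i == k)%:R = F k.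
  rewrite (bigD1 k)//= eqxx mulr1 big1 ?addr0// => i /negbTE ->.
  by rewrite mulr0.
have inner i : \sum_j S i j * (v i + c * (i == k)%:R) * (v j + c * (j == k)%:R) =
    \sum_j S i j * v i * v j + c * (S i k * v i)
    + c * (\sum_j S i j * v j) * (i == k)%:R + c ^+ 2 * S i k * (i == k)%:R.
  rewrite -[S i k * v i](pick (fun j => S i j * v i)).
  rewrite -[S i k](pick (fun j => S i j)).
  rewrite !mulr_sumr !mulr_suml -!big_split /=; apply: eq_bigr => j _.
  by ring.
rewrite /qform (eq_bigr _ (fun i _ => inner i)) !big_split /=.
rewrite (pick (fun i => c * (\sum_j S i j * v j))) (pick (fun i => c ^+ 2 * S i k)).
rewrite -mulr_sumr (_ : \sum_i S i k * v i = \sum_j S k j * v j).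
  by ring.
by apply: eq_bigr => i _; rewrite symS.
Qed.

(* Completing squares splits off from [S] one rank-one form per row. *)
Lemma psd_nsd_sum_le0 (R : realFieldType) (n : nat) (S H : 'I_n -> 'I_n -> R) :
  (forall i j, S i j = S j i) ->
  (forall v, 0 <= qform S v) -> (forall v, qform H v <= 0) ->
  \sum_(i < n) \sum_(j < n) S i j * H i j <= 0.
Proof.
move=> symS psdS nsdH.
(* Induction on the number [m] of leading rows allowed to be nonzero; by symmetry the columns vanish
   together with the rows. *)
suff main m : (m <= n)%N -> forall S : 'I_n -> 'I_n -> R,
    (forall i j, S i j = S j i) -> (forall v, 0 <= qform S v) ->
    (forall i j : 'I_n, (m <= i)%N -> S i j = 0) ->
    \sum_(i < n) \sum_(j < n) S i j * H i j <= 0.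
  by apply: (main n) => // i j; rewrite leqNgt ltn_ord.
elim: m {S symS psdS} => [|m IHm] le_mn S symS psdS S0.
  by rewrite big1// => i _; rewrite big1// => j _; rewrite S0 ?mul0r.
pose k := Ordinal le_mn.
have Skk v c : 0 <= qform S v + c * 2 * (\sum_j S k j * v j) + c ^+ 2 * S k k.
  by rewrite -qform_shift.
have row0 (T : 'I_n -> 'I_n -> R) : (forall i j : 'I_n, (m < i)%N -> T i j = 0) ->
    (forall j, T k j = 0) -> forall i j : 'I_n, (m <= i)%N -> T i j = 0.
  move=> T0 Tk i j; rewrite leq_eqVlt => /orP[/eqP mi|/T0->//].
  by rewrite (_ : i = k) ?Tk//; apply: val_inj.
have qf0 : qform S (fun=> 0) = 0.
  by rewrite /qform big1// => i _; rewrite big1// => j _; rewrite !mulr0.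
have : 0 <= S k k.
  have := Skk (fun=> 0) 1; rewrite qf0 big1 ?mulr0 ?expr1n ?mul1r ?add0r//.
  by move=> j _; rewrite mulr0.
rewrite le_eqVlt => /orP[/eqP Skk0|Skk0].
  apply: (IHm (ltnW le_mn)) => //; apply: row0 => // j.
  pose e := fun i : 'I_n => (i == j)%:R : R.
  have sumE : \sum_i S k i * e i = S k j.
    rewrite (bigD1 j)//= /e eqxx mulr1 big1 ?addr0// => i /negbTE ->.
    by rewrite mulr0.
  (* With a zero pivot the polynomial in [c] is affine. If its slope were nonzero, the [c] chosen
     here would give it the value [-1]. *)
  apply/eqP; apply: contraT => Skj.
  have := Skk e (- (qform S e + 1) / (2 * S k j)).
  rewrite sumE -Skk0 mulr0 addr0.
  rewrite (_ : _ + _ = -1) ?ler0N1//.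
  by field.
pose l v := \sum_j S k j * v j.
(* Schur complement of the pivot. Its form at [v] is the minimum over [c] of the shifted form,
   attained at [c = - l v / S k k], so it stays nonnegative, while row and column [k] become
   zero. *)
pose S' i j := S i j - S k i * S k j / S k k.
have qS' v : qform S' v = qform S v - l v ^+ 2 / S k k.
  rewrite /qform /l expr2 !mulr_suml -sumrB; apply: eq_bigr => i _.
  rewrite mulr_sumr mulr_suml -sumrB; apply: eq_bigr => j _.
  by rewrite /S'; ring.
have -> : \sum_i \sum_j S i j * H i j =
    \sum_i \sum_j S' i j * H i j + qform H (fun i => S k i) / S k k.
  rewrite /qform mulr_suml -big_split; apply: eq_bigr => i _ /=.
  rewrite mulr_suml -big_split; apply: eq_bigr => j _ /=.
  by rewrite /S'; ring.
have HS : qform H (fun i => S k i) / S k k <= 0.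
  by rewrite pmulr_lle0 ?invr_gt0.
suff : \sum_i \sum_j S' i j * H i j <= 0 by lra.
apply: (IHm (ltnW le_mn)).
- by move=> i j; rewrite /S' symS [S k i * _]mulrC.
- move=> v; rewrite qS'.
  have := Skk v (- l v / S k k); rewrite -/(l v).
  suff -> : qform S v + - l v / S k k * 2 * l v + (- l v / S k k) ^+ 2 * S k k
    = qform S v - l v ^+ 2 / S k k by [].
  by field; rewrite gt_eqF.
- apply: row0 => [i j mi|j]; rewrite /S'.
    by rewrite S0// symS S0// !mul0r subrr.
  by rewrite mulrAC divff ?gt_eqF// mul1r subrr.
Qed.

(** Against a symmetric [H] only the symmetric part of [A] counts, and it has the same quadratic
    form. This covers coefficients [a i j] that are not assumed symmetric. *)
Lemma elliptic_trace_le0 (R : realFieldType) (n : nat) (A H : 'I_n -> 'I_n -> R) :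
  (forall v, 0 <= qform A v) -> (forall i j, H i j = H j i) ->
  (forall v, qform H v <= 0) -> \sum_(i < n) \sum_(j < n) A i j * H i j <= 0.
Proof.
move=> psdA symH nsdH; pose S i j := (A i j + A j i) / 2.
have swap (F : 'I_n -> 'I_n -> R) :
    \sum_i \sum_j (F i j + F j i) / 2 = \sum_i \sum_j F i j.
  transitivity (\sum_i \sum_j F i j / 2 + \sum_i \sum_j F j i / 2).
    rewrite -big_split; apply: eq_bigr => i _ /=; rewrite -big_split.
    by apply: eq_bigr => j _ /=; rewrite mulrDl.
  rewrite [X in _ + X]exchange_big /= -big_split; apply: eq_bigr => i _ /=.
  by rewrite -big_split; apply: eq_bigr => j _ /=; field.
rewrite -swap (eq_bigr (fun i => \sum_j S i j * H i j)) => [|i _]; last first.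
  by apply: eq_bigr => j _; rewrite /S (symH j i); ring.
apply: psd_nsd_sum_le0 => // [i j|v]; first by rewrite /S addrC.
suff -> : qform S v = qform A v by [].
rewrite /qform -[RHS]swap; apply: eq_bigr => i _; apply: eq_bigr => j _.
by rewrite /S; ring.
Qed.

(** * One-variable tests and strict derivatives *)

Lemma is_derive_line (R : realType) (V : normedModType R) (w : V -> R)
    (y v : V) (s d : R) :
  is_derive (y + s *: v) v w d -> is_derive s 1 (fun r => w (y + r *: v)) d.
Proof.
have E : (fun h : R => h^-1 *: (((fun r => w (y + r *: v)) \o shift s) (h *: 1)
      - w (y + s *: v))) =
    (fun h : R => h^-1 *: ((w \o shift (y + s *: v)) (h *: v) - w (y + s *: v))).
  apply/funext => h /=; congr (_ *: (w _ - _)).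
  by rewrite scalerDl [h *: 1]mulr1 addrCA.
by case=> wd wE; split; rewrite /derivable /derive E.
Qed.

(** One-sided, because the contact with the barrier may occur at the final time of the cylinder,
    where only earlier times can be compared. *)
Lemma derive_ge0_at_left_max (R : realType) (f : R -> R) (t d e : R) : 0 < e ->
  is_derive t 1 f d -> (forall s, t - e < s < t -> f s <= f t) -> 0 <= d.
Proof.
move=> e0 [fd fE] fmax; rewrite leNgt; apply/negP => d0.
have : h^-1 *: ((f \o shift t) (h *: 1) - f t) @[h --> 0^'] --> d.
  by rewrite -fE; exact: fd.
move=> /cvgr_lt /(_ _ d0) /nbhs_ballP [r /= r0 rP].
pose h := - (Num.min e r / 2).
have [he hr] : Num.min e r <= e /\ Num.min e r <= r by rewrite !ge_min !lexx orbT.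
have m0 : 0 < Num.min e r by rewrite lt_min e0.
have hlt0 : h < 0 by rewrite /h; lra.
have hball : ball 0 r h.
  by rewrite /ball /= /ball_ sub0r normrN ltr0_norm// /h; lra.
have A := rP h hball (ltr0_neq0 hlt0).
have B : f (t + h) <= f t by apply: fmax; rewrite /h; apply/andP; split; lra.
move: A; rewrite /= [h *: 1]mulr1 [_ *: _]/(_ * _) [h + t]addrC nmulr_rlt0 ?invr_lt0//.
by lra.
Qed.

(** The second derivative is required at [0] only. If [c] were positive, [g] would be positive just
    to the right of [0], and the mean value theorem would make [f] exceed [f 0] there. *)
Lemma second_derivative_test (R : realType) (f g : R -> R) (c e : R) : 0 < e ->
  (forall s : R, `|s| < e -> is_derive s 1 f (g s)) -> is_derive (0 : R) 1 g c ->
  (forall s : R, `|s| < e -> f s <= f 0) -> g 0 = 0 /\ c <= 0.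
Proof.
move=> e0 fg gc fmax.
have itvE s : (s \in `](- e), e[) = (`|s| < e) by rewrite in_itv/= ltr_norml.
have g00 : g 0 = 0.
  have [fd <-] : is_derive (0 : R) 1 f (g 0) by apply: fg; rewrite normr0.
  have fd0 : is_derive (0 : R) 1 f 0.
    apply: (@derive1_at_max _ _ (- e) e); first by lra.
    + by move=> t; rewrite itvE => /fg[].
    + by rewrite itvE normr0.
    + by move=> t; rewrite itvE => /fmax.
  exact: derive_val.
split=> //; rewrite leNgt; apply/negP => c0.
have : h^-1 *: ((g \o shift 0) (h *: 1) - g 0) @[h --> 0^'] --> c.
  by case: gc => gd <-; exact: gd.
move=> /cvgr_gt /(_ _ c0) /nbhs_ballP [r /= r0 rP].
pose h := Num.min e r / 2.
have [he hr] : Num.min e r <= e /\ Num.min e r <= r by rewrite !ge_min !lexx orbT.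
have m0 : 0 < Num.min e r by rewrite lt_min e0.
have h0 : 0 < h by rewrite /h; lra.
have [hle hlr] : h < e /\ h < r by rewrite /h; lra.
have fgh s : s \in `[0, h] -> is_derive s 1 f (g s).
  by rewrite in_itv/= => /andP[s0 sh]; apply: fg; rewrite ger0_norm; lra.
have fgo s : s \in `]0, h[ -> is_derive s 1 f (g s).
  by rewrite in_itv/= => /andP[s0 sh]; apply: fgh; rewrite in_itv/= !ltW.
have fcont : {within `[0, h], continuous f}.
  by apply: derivable_within_continuous => s /fgh[].
have [s] := MVT h0 fgo fcont.
rewrite in_itv/= => /andP[s0 sh] fE.
have := fmax h; rewrite gtr0_norm// => /(_ hle).
have : 0 < g s; last first.
  by move=> gs0; have := mulr_gt0 gs0 h0; rewrite subr0 in fE; lra.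
have sball : ball 0 r s.
  by rewrite /ball /= /ball_ sub0r normrN gtr0_norm//; lra.
have := rP s sball (lt0r_neq0 s0).
by rewrite g00 subr0 /= addr0 [s *: 1]mulr1 [_ *: _]/(_ * _) pmulr_rgt0 ?invr_gt0.
Qed.

(** * Strict directional derivatives and the symmetry of second derivatives *)

Section strict.
Variables (R : realType) (V : normedModType R).
Implicit Types (w : V -> R) (x v : V) (d : R).

Lemma cvg_pair_nbhs (T : Type) (F : set_system T) (FF : Filter F)
    (f : T -> V) (g : T -> R) x (y : R) :
  f t @[t --> F] --> x -> g t @[t --> F] --> y ->
  (f t, g t) @[t --> F] --> (x, y).
Proof.
move=> fx gy; exact: (@cvg_pair T V R F (nbhs x) (nbhs y) FF _ _ f g fx gy).
Qed.

(* Unlike mere derivability along [v], this strict version (the base point moves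
   too) is additive in the direction. *)
Definition strict_derive w x v d := forall eps : R, 0 < eps ->
  \forall p \near (x, 0 : R),
    `|w (p.1 + p.2 *: v) - w p.1 - p.2 * d| <= eps * `|p.2|.

(** The mean value theorem on the segment from [y] to [y + h *: v] replaces the increment by [h]
    times a derivative at an intermediate point, which is close to the one at [x] by continuity. *)
Lemma strict_derive_continuous w x v :
  (forall y, derivable w y v) -> {for x, continuous ('D_v w)} ->
  strict_derive w x v ('D_v w x).
Proof.
move=> wd wc eps eps0.
have /cvgrPdist_le /(_ _ eps0) /nbhs_ballP [r /= r0 rP] := wc.
have near_small : \forall p \near (x, 0 : R), `|p.1 - x| + `|p.2| * `|v| < r.
  have : (fun p : V * R => `|p.1 - x| + `|p.2| * `|v|) p @[p --> (x, 0 : R)] -->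
      `|x - x| + `|0 : R| * `|v|.
    apply: cvgD.
      apply: cvg_norm; apply: cvgB; last exact: cvg_cst.
      exact: cvg_fst.
    apply: cvgM; last exact: cvg_cst.
    by apply: cvg_norm; exact: cvg_snd.
  rewrite subrr !normr0 mul0r addr0 => /cvgr_lt; exact.
apply: filterS near_small => -[y h] /= pr.
pose phi s := w (y + (h * s) *: v).
have dphi (s : R) : is_derive s 1 phi ('D_v w (y + (h * s) *: v) * h).
  apply: (@is_derive1_comp _ (fun s => w (y + s *: v)) (fun s => h * s)).
    by apply: is_derive_line; apply: DeriveDef.
  by apply: is_derive_eq => //; rewrite [_ *: _]mulr1.
have phic : {within `[0, 1], continuous phi}.
  by apply: derivable_within_continuous => s _; have [] := dphi s.
have [s] := MVT ltr01 (fun s _ => dphi s) phic.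
rewrite in_itv/= => /andP[s0 s1]; rewrite /phi mulr1 mulr0 scale0r addr0 subr0 mulr1 => ->.
rewrite [h * 'D_v w x]mulrC -mulrBl normrM ler_wpM2r// distrC.
apply: rP; rewrite -ball_normE /=; apply: le_lt_trans pr.
rewrite distrC addrAC (le_trans (ler_normD _ _))// lerD2l normrZ ler_wpM2r//.
by rewrite normrM ler_piMr// gtr0_norm// ltW.
Qed.

(** The displacement is made in two legs; the second starts at [p.1 + p.2 *: v], a moving base point
    that still tends to [x]. *)
Lemma strict_deriveD w x v v' d d' :
  strict_derive w x v d -> strict_derive w x v' d' ->
  strict_derive w x (v + v') (d + d').
Proof.
move=> wv wv' eps eps0.
have eps20 : 0 < eps / 2 by lra.
have moved : (fun p : V * R => (p.1 + p.2 *: v, p.2)) p @[p --> (x, 0 : R)]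
    --> (x, 0 : R).
  suff : (fun p : V * R => p.1 + p.2 *: v) p @[p --> (x, 0 : R)] --> x.
    by move=> /cvg_pair_nbhs; apply; exact: cvg_snd.
  have : (fun p : V * R => p.1 + p.2 *: v) p @[p --> (x, 0 : R)]
      --> x + (0 : R) *: v.
    by apply: cvgD; [exact: cvg_fst|apply: cvgZr_tmp; exact: cvg_snd].
  by rewrite scale0r addr0.
have := moved _ (wv' _ eps20); rewrite /= => near_v'.
near=> p.
have A : `|w (p.1 + p.2 *: v) - w p.1 - p.2 * d| <= eps / 2 * `|p.2|.
  by near: p; exact: wv.
have B : `|w (p.1 + p.2 *: v + p.2 *: v') - w (p.1 + p.2 *: v) - p.2 * d'|
    <= eps / 2 * `|p.2| by near: p.
rewrite scalerDr addrA.
have -> : w (p.1 + p.2 *: v + p.2 *: v') - w p.1 - p.2 * (d + d') =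
  (w (p.1 + p.2 *: v + p.2 *: v') - w (p.1 + p.2 *: v) - p.2 * d') +
  (w (p.1 + p.2 *: v) - w p.1 - p.2 * d) by ring.
by rewrite (le_trans (ler_normD _ _))//; lra.
Unshelve. all: by end_near. Qed.

Lemma strict_deriveZ w x v d c :
  strict_derive w x v d -> strict_derive w x (c *: v) (c * d).
Proof.
move=> wv eps eps0.
(* Dividing by [1 + |c|] instead of [|c|] includes the case [c = 0]. *)
have c0 : 0 < 1 + `|c| by rewrite ltr_pwDl.
have moved : (fun p : V * R => (p.1, p.2 * c)) p @[p --> (x, 0 : R)]
    --> (x, 0 : R).
  apply: cvg_pair_nbhs; first exact: cvg_fst.
  rewrite -[X in _ --> X](mul0r c); apply: cvgM; last exact: cvg_cst.
  exact: cvg_snd.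
have near_c : \forall p \near (x, 0 : R), `|w (p.1 + (p.2 * c) *: v) - w p.1
    - p.2 * c * d| <= eps / (1 + `|c|) * `|p.2 * c|.
  exact: (moved _ (wv _ (divr_gt0 eps0 c0))).
apply: filterS near_c => p.
rewrite scalerA -mulrA => /le_trans; apply.
rewrite normrM mulrCA mulrC ler_wpM2r// mulrAC ler_pdivrMr// ler_wpM2l ?(ltW eps0)//.
by rewrite lerDr.
Qed.

Lemma strict_derive_sum (I : Type) (r : seq I) w x (v : I -> V) (d : I -> R) :
  (forall i, strict_derive w x (v i) (d i)) ->
  strict_derive w x (\sum_(i <- r) v i) (\sum_(i <- r) d i).
Proof.
move=> wv; elim: r => [|i r IHr]; last by rewrite !big_cons; exact: strict_deriveD.
rewrite !big_nil => eps eps0; apply: filterE => p.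
by rewrite scaler0 addr0 subrr mulr0 subr0 normr0 mulr_ge0// ltW.
Qed.

Lemma is_derive_strict w x v d : strict_derive w x v d -> is_derive x v w d.
Proof.
move=> wv.
suff H : h^-1 *: ((w \o shift x) (h *: v) - w x) @[h --> 0^'] --> d.
  by split; [apply/cvg_ex; exists d|exact: cvg_lim].
apply/cvgrPdist_le => eps eps0.
have moved : (fun h : R => (x, h)) h @[h --> (0 : R)] --> (x, 0 : R).
  by apply: cvg_pair_nbhs; [exact: cvg_cst|exact: cvg_id].
have /nbhs_ballP [r /= r0 rP] := moved _ (wv _ eps0).
apply/nbhs_ballP; exists r => //= h /rP /= hP h0.
rewrite distrC [_ *: (_ - _)]/(_ * _) [h *: v + x]addrC.
have -> : h^-1 * (w (x + h *: v) - w x) - d =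
  h^-1 * (w (x + h *: v) - w x - h * d) by field.
by rewrite normrM normfV mulrC ler_pdivrMr ?normr_gt0.
Qed.

(** The mean value theorem along [u], applied to the difference of [w] on two parallel segments,
    leaves an increment of ['D_u w] along [v] from the base point [x + a *: u]. That point varies
    with [s], so a strict derivative is needed. *)
Lemma schwarz_second_difference w x u v d :
  (forall y, derivable w y u) -> strict_derive ('D_u w) x v d ->
  forall eps : R, 0 < eps -> exists2 r : R, 0 < r & forall s : R, 0 < s < r ->
    `|w (x + s *: u + s *: v) - w (x + s *: u) - w (x + s *: v) + w x
      - s ^+ 2 * d| <= eps * s ^+ 2.
Proof.
move=> wd wv eps eps0.
have /nbhs_ballP [r /= r0 rP] := wv _ eps0.
have u0 : 0 < 1 + `|u| by rewrite ltr_pwDl.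
exists (r / (1 + `|u|)) => [|s /andP[s0]]; first exact: divr_gt0.
rewrite ltr_pdivlMr// => sr.
pose phi a := w (x + s *: v + a *: u) - w (x + a *: u).
have dphi (a : R) : is_derive a 1 phi ('D_u w (x + s *: v + a *: u) - 'D_u w (x + a *: u)).
  by apply: is_deriveB; apply: is_derive_line; apply: DeriveDef.
have phic : {within `[0, s], continuous phi}.
  by apply: derivable_within_continuous => a _; have [] := dphi a.
have [a] := MVT s0 (fun a _ => dphi a) phic.
rewrite in_itv/= => /andP[a0 a1]; rewrite /phi !scale0r !addr0 subr0 => E.
have -> : w (x + s *: u + s *: v) - w (x + s *: u) - w (x + s *: v) + w x - s ^+ 2 * d =
   w (x + s *: v + s *: u) - w (x + s *: u) - (w (x + s *: v) - w x) - s ^+ 2 * d.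
  by rewrite [x + s *: u + _]addrAC; ring.
rewrite E.
have -> : ('D_u w (x + s *: v + a *: u) - 'D_u w (x + a *: u)) * s - s ^+ 2 * d =
  s * ('D_u w (x + a *: u + s *: v) - 'D_u w (x + a *: u) - s * d).
  by rewrite [x + s *: v + _]addrAC; ring.
rewrite normrM gtr0_norm// expr2 mulrCA ler_pM2l//.
have s1 : s <= s * (1 + `|u|) by rewrite mulrDr mulr1 lerDl mulr_ge0// ltW.
have := rP (x + a *: u, s); rewrite /= (gtr0_norm s0); apply.
split; rewrite -ball_normE /=; last by rewrite sub0r normrN (gtr0_norm s0); lra.
rewrite opprD addrA subrr sub0r normrN normrZ gtr0_norm//.
apply: le_lt_trans sr; rewrite ler_pM//; [exact: ltW|exact: ltW|].
by rewrite lerDr.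
Qed.

(** The second difference is symmetric in [u] and [v]; divided by [s ^+ 2] it is within [eps / 2] of
    both [d] and [d']. *)
Lemma schwarz w x u v d d' :
  (forall y, derivable w y u) -> (forall y, derivable w y v) ->
  strict_derive ('D_u w) x v d -> strict_derive ('D_v w) x u d' -> d = d'.
Proof.
move=> wu wv wuv wvu; apply/eqP; rewrite -subr_eq0 -normr_le0.
apply/ler_addgt0Pr => eps eps0; rewrite add0r.
have eps20 : 0 < eps / 2 by lra.
have [r r0 rP] := schwarz_second_difference wu wuv eps20.
have [r' r'0 r'P] := schwarz_second_difference wv wvu eps20.
have m0 : 0 < Num.min r r' by rewrite lt_min r0.
have [mr mr'] : Num.min r r' <= r /\ Num.min r r' <= r' by rewrite !ge_min !lexx orbT.
pose s := Num.min r r' / 2.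
have s0 : 0 < s by rewrite /s; lra.
have [sr sr'] : 0 < s < r /\ 0 < s < r' by rewrite s0 /s; split; lra.
have := r'P _ sr'; have := rP _ sr; rewrite [x + s *: v + s *: u]addrAC.
set w2 := w (x + s *: u + s *: v) => A B.
have s20 : 0 < s ^+ 2 by rewrite exprn_gt0.
rewrite -(ler_pM2r s20) -[X in _ * X <= _](gtr0_norm s20) -normrM.
move: A B; rewrite !ler_norml => /andP[A1 A2] /andP[B1 B2].
by apply/andP; split; lra.
Qed.

End strict.

(** * The barrier profile *)

Section iterated_exponential.
Variable R : realType.
Implicit Types y z : R.

Definition iexp (i : nat) y : R := iter i expR y.

Arguments iexp : simpl never.

(** [iexp1 i] and [iexp2 i] are the first and second derivatives of [iexp i]. Unfolded, [iexp1 i] is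
    the product of [iexp j] for [1 <= j <= i], which matches the product of iterated logarithms in
    (F-2). *)
Fixpoint iexp1 (i : nat) y : R :=
  if i is k.+1 then iexp k.+1 y * iexp1 k y else 1.

Fixpoint iexp2 (i : nat) y : R :=
  if i is k.+1 then iexp k.+1 y * (iexp1 k y ^+ 2 + iexp2 k y) else 0.

Lemma is_derive_iexp i y : is_derive y 1 (iexp i) (iexp1 i y).
Proof.
elim: i => [|i IHi]; first exact: is_derive_id.
exact: (@is_derive1_comp _ expR (iexp i)).
Qed.

Lemma is_derive_iexp1 i y : is_derive y 1 (iexp1 i) (iexp2 i y).
Proof.
elim: i => [|i IHi]; first exact: is_derive_cst.
have := @is_deriveM _ _ (iexp i.+1) (iexp1 i) y 1 _ _ (is_derive_iexp i.+1 y) IHi.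
move=> /is_derive_eq; apply.
by rewrite /GRing.scale /=; ring.
Qed.

Lemma le_iexp i y : y <= iexp i y.
Proof.
elim: i => // i /le_trans; apply; apply: le_trans (expR_ge1Dx _).
by rewrite lerDr.
Qed.

Lemma iexp1_ge1 i y : 1 <= y -> 1 <= iexp1 i y.
Proof.
move=> y1; elim: i => //= i IHi; rewrite -[1]mulr1 ler_pM//.
exact: le_trans y1 (le_iexp i.+1 y).
Qed.

Lemma iexp2_ge0 i y : 1 <= y -> 0 <= iexp2 i y.
Proof.
move=> y1; elim: i => //= i IHi; rewrite mulr_ge0 ?addr_ge0 ?sqr_ge0//.
exact: le_trans (le_trans ler01 y1) (le_iexp i.+1 y).
Qed.

(** By induction [iexp2 i] is at most [i] times the square of [iexp1 i], since each new factor
    [E >= 1] satisfies [E <= E ^+ 2]. At [i = m] the expression in parentheses is the (F-2)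
    denominator at [iexp m.+1 y] without its last power. *)
Lemma iexp2_le i y : 1 <= y ->
  iexp2 i.+1 y <= i.+1%:R * (iexp i.+1 y * iexp1 i y ^+ 2).
Proof.
move=> y1.
have E1 j : 1 <= iexp j y := le_trans y1 (le_iexp j y).
suff H : iexp2 i y <= i%:R * iexp1 i y ^+ 2.
  rewrite mulrCA /= ler_pM2l ?(lt_le_trans ltr01 (E1 i.+1))//.
  by rewrite -natr1 mulrDl mul1r addrC lerD2r.
elim: i => [|i IHi]; first by rewrite mul0r.
rewrite [iexp2 _ _]/= [iexp1 _ _]/= exprMn.
set E := iexp i.+1 y; set P := iexp1 i y ^+ 2.
have P0 : 0 <= P by rewrite sqr_ge0.
have EE : E <= E ^+ 2 by rewrite expr2 ler_peMl ?E1// (le_trans ler01 (E1 _)).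
have : E * (P + iexp2 i y) <= E * (i.+1%:R * P).
  rewrite ler_wpM2l ?(le_trans ler01 (E1 _))//.
  by rewrite -natr1 mulrDl mul1r addrC lerD2r.
move=> /le_trans; apply; rewrite mulrCA ler_wpM2l// ler_wpM2r//.
Qed.

Lemma logit_iexp i m y : (i <= m)%N -> logit i (iexp m y) = iexp (m - i) y.
Proof.
elim: i m => [|i IHi] m; first by rewrite subn0.
move=> im; rewrite /logit iterS -/(logit i _) IHi; last exact: ltnW.
by rewrite -[in LHS](subnSK im) /= expRK.
Qed.

(* The denominator in (F-2). *)
Definition absorption (m : nat) (eps u : R) : R :=
  u * (\prod_(1 <= i < m.+1) logit i u) ^+ 2 * powR (logit m.+1 u) (2 + eps).

(** The logarithms of orders [1] to [m] of [iexp m.+1 y] are [iexp m y] down to [iexp 1 y], whose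
    product is [iexp1 m y]; the one of order [m.+1] is [y]. *)
Lemma absorption_iexp m eps y :
  absorption m eps (iexp m.+1 y) = iexp m.+1 y * iexp1 m y ^+ 2 * powR y (2 + eps).
Proof.
rewrite /absorption logit_iexp// subnn; congr (_ * _ ^+ 2 * _).
rewrite big_nat_rev /= (eq_big_nat _ _ (F2 := fun i => iexp i y)).
  elim: m => [|m IHm]; first by rewrite big_geq.
  by rewrite big_nat_recr//= IHm mulrC.
move=> i /andP[i1 im]; rewrite addSn add0n subSS logit_iexp ?leq_subr//.
  by rewrite subKn// ltnW.
Qed.

(** The lower bound on the iterated logarithms of [w] keeps every [ln] on positive arguments, where
    it is increasing, and keeps all factors positive. *)
Lemma absorption_mono m eps (w u : R) : 0 <= eps ->
  (forall i, (i <= m.+1)%N -> 1 <= logit i w) -> w <= u ->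
  0 < absorption m eps w <= absorption m eps u.
Proof.
move=> eps0 w1 wu.
have wu_log i : (i <= m.+1)%N -> logit i w <= logit i u.
  elim: i => // i IHi im; rewrite /logit !iterS -!/(logit i _).
  have wi := w1 i (ltnW im); have wui := IHi (ltnW im).
  by rewrite ler_ln// posrE (lt_le_trans ltr01)// (le_trans wi).
have prod1 : 1 <= \prod_(1 <= i < m.+1) logit i w.
  rewrite big_nat; elim/big_ind: _ => [//|a b a1 b1|i /andP[_ im]].
    by rewrite -[1]mulr1 ler_pM.
  by rewrite w1// ltnW.
have pw : 0 < powR (logit m.+1 w) (2 + eps).
  by rewrite powR_gt0// (lt_le_trans ltr01)// w1.
have w0 : 0 < w := lt_le_trans ltr01 (w1 0%N isT).
apply/andP; split.
  by rewrite /absorption mulr_gt0// mulr_gt0// exprn_gt0// (lt_le_trans ltr01).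
have prod_le : \prod_(1 <= i < m.+1) logit i w <= \prod_(1 <= i < m.+1) logit i u.
  rewrite !big_nat; apply: ler_prod => i /andP[_ im].
  by rewrite (wu_log _ (ltnW im)) (le_trans ler01 (w1 _ (ltnW im))).
have p0 := le_trans ler01 prod1.
rewrite /absorption ler_pM//.
- by rewrite mulr_ge0 ?sqr_ge0// ltW.
- exact: ltW.
- by rewrite ler_pM ?sqr_ge0// ?(ltW w0)// lerXn2r// nnegrE (le_trans p0 prod_le).
- have l0 : 0 <= logit m.+1 w by rewrite (le_trans ler01 (w1 _ (leqnn _))).
  have l1 := wu_log m.+1 (leqnn _).
  by apply: ge0_ler_powR; rewrite ?nnegrE// ?(le_trans l0 l1)//; lra.
Qed.

(** The bounds on the logarithms serve the monotonicity of [absorption]. The bound [z^-1 <= Phi z]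
    makes the barrier infinite at [z = 0] and large wherever [z] is small. *)
Lemma barrier_profile (m : nat) (eps : R) : 0 < eps ->
  exists (Phi Phi1 Phi2 : R -> R) (C : R), forall z, 0 < z <= 1 ->
    [/\ is_derive z 1 Phi (Phi1 z), is_derive z 1 Phi1 (Phi2 z),
        `|Phi1 z| <= C * absorption m eps (Phi z) /\
        `|Phi2 z| <= C * absorption m eps (Phi z),
        forall i, (i <= m.+1)%N -> 1 <= logit i (Phi z) & z^-1 <= Phi z].
Proof.
move=> eps0.
(* With [y = z^-k], [Phi''] is of order [h (Phi) y^-eps z^-2], so [k eps >= 2] suffices. *)
pose k := (Num.truncn (2 / eps)).+1.
have keps : 2 <= k%:R * eps.
  rewrite -ler_pdivrMr//; apply: ltW; exact: truncnS_gt.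
pose Y z := z^-1 ^+ k.
pose Y1 z := - (k%:R * z^-1 ^+ k.+1).
pose Y2 z := k%:R * k.+1%:R * z^-1 ^+ k.+2.
have dpow j z : 0 < z ->
    is_derive z 1 (fun z : R => z^-1 ^+ j.+1) (- (j.+1%:R * z^-1 ^+ j.+2)).
  move=> z0.
  have dinv : is_derive z 1 (fun z : R => z^-1) (- z ^- 2 *: (1 : R)).
    by apply: (@is_deriveV _ id) => //; rewrite gt_eqF.
  have := is_deriveX j.+1 dinv => /is_derive_eq; rewrite exprfctE; apply.
  by rewrite /GRing.scale /= -exprVn !exprS; ring.
have dY z : 0 < z -> is_derive z 1 Y (Y1 z) by exact: dpow.
have dY1 z : 0 < z -> is_derive z 1 Y1 (Y2 z).
  move=> z0; have dp := dpow k z z0.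
  have := is_deriveZ (- k%:R) dp => /is_derive_eq.
  rewrite (_ : - k%:R \*: _ = Y1); last first.
    by apply/funext => t; rewrite /Y1 -mulNr.
  by apply; rewrite /Y2 /GRing.scale /=; ring.
pose Phi z := iexp m.+1 (Y z).
pose Phi1 z := iexp1 m.+1 (Y z) * Y1 z.
pose Phi2 z := iexp2 m.+1 (Y z) * Y1 z ^+ 2 + iexp1 m.+1 (Y z) * Y2 z.
pose C : R := m.+1%:R * k%:R ^+ 2 + k%:R * k.+1%:R.
exists Phi, Phi1, Phi2, C => z /andP[z0 z1].
have p1 : 1 <= z^-1 by rewrite invf_ge1.
have p0 : 0 <= z^-1 := le_trans ler01 p1.
have y1 : 1 <= Y z by rewrite exprn_ege1.
have E1 j : 1 <= iexp j (Y z) := le_trans y1 (le_iexp j (Y z)).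
have k1 : 1 <= k%:R :> R by rewrite ler1n.
have kS1 : 1 <= k.+1%:R :> R by rewrite ler1n.
set G := iexp m.+1 (Y z) * iexp1 m (Y z) ^+ 2.
have P1 := iexp1_ge1 m y1.
have I1 : 0 <= iexp1 m.+1 (Y z) <= G.
  rewrite (le_trans ler01 (iexp1_ge1 _ y1)) /= /G ler_wpM2l ?(le_trans ler01 (E1 _))//.
  by rewrite expr2 ler_peMl// (le_trans ler01).
have I2 : 0 <= iexp2 m.+1 (Y z) <= m.+1%:R * G by rewrite iexp2_ge0//= iexp2_le.
set T := powR (Y z) (2 + eps).
have hE : absorption m eps (Phi z) = G * T by rewrite /Phi absorption_iexp.
(* Here [keps] enters: [k (2 + eps) >= 2 k + 2]. This is the highest power of [z^-1] that occurs,
   coming from the square of [Y1]. *)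
have TE : z^-1 ^+ (k.+1).*2 <= T.
  rewrite /T /Y -!powR_mulrn// -powRrM; apply: ler_powR => //.
  by rewrite -muln2 mulnC natrM -natr1; nra.
have T0 : 0 <= T by exact: powR_ge0.
have Tj j : (j <= (k.+1).*2)%N -> 0 <= z^-1 ^+ j <= T.
  move=> jk; rewrite exprn_ge0//=; apply: le_trans TE.
  exact: ler_weXn2l.
have G0 : 0 <= G by have /andP[? ?] := I1; lra.
have kle : (k.+1 <= k.+1.*2)%N by rewrite -addnn leq_addr.
have Y1b : `|Y1 z| <= k%:R * T.
  have -> : `|Y1 z| = k%:R * z^-1 ^+ k.+1.
    by rewrite /Y1 normrN ger0_norm// mulr_ge0// exprn_ge0.
  rewrite ler_wpM2l//.
  by have /andP[] := Tj k.+1 kle.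
have Y1sb : Y1 z ^+ 2 <= k%:R ^+ 2 * T.
  rewrite /Y1 sqrrN exprMn ler_wpM2l ?sqr_ge0// -exprM muln2.
  by have /andP[] := Tj _ (leqnn _).
have Y2b : `|Y2 z| <= k%:R * k.+1%:R * T.
  have -> : `|Y2 z| = k%:R * k.+1%:R * z^-1 ^+ k.+2.
    by rewrite /Y2 ger0_norm// mulr_ge0 ?exprn_ge0// mulr_ge0.
  rewrite ler_wpM2l//.
  suff /Tj/andP[] : (k.+2 <= k.+1.*2)%N by [].
  by rewrite -addnn addSn ltnS leq_addl.
have kC : k%:R <= C.
  rewrite /C; have : 0 <= m.+1%:R * k%:R ^+ 2 :> R by rewrite mulr_ge0 ?sqr_ge0.
  by nra.
split.
- apply: (@is_derive1_comp _ (iexp m.+1) Y); last exact: dY.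
  exact: is_derive_iexp.
- have A : is_derive z 1 (iexp1 m.+1 \o Y) (iexp2 m.+1 (Y z) * Y1 z).
    apply: (@is_derive1_comp _ (iexp1 m.+1) Y); last exact: dY.
    exact: is_derive_iexp1.
  have := is_deriveM A (dY1 z z0) => /is_derive_eq; apply.
  by rewrite /Phi2 /GRing.scale /=; ring.
- split.
    have /andP[I10 I1G] := I1; rewrite hE normrM (ger0_norm I10).
    apply: (le_trans (ler_pM I10 (normr_ge0 _) I1G Y1b)).
    by rewrite mulrCA ler_wpM2r// mulr_ge0.
  have /andP[I10 I1G] := I1; have /andP[I20 I2G] := I2.
  rewrite hE /Phi2 /C mulrDl; apply: le_trans (ler_normD _ _) (lerD _ _).
    rewrite normrM (ger0_norm I20) (ger0_norm (sqr_ge0 _)).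
    apply: (le_trans (ler_pM I20 (sqr_ge0 _) I2G Y1sb)).
    by rewrite le_eqVlt; apply/orP; left; apply/eqP; ring.
  rewrite normrM (ger0_norm I10).
  apply: (le_trans (ler_pM I10 (normr_ge0 _) I1G Y2b)).
  by rewrite le_eqVlt; apply/orP; left; apply/eqP; ring.
- by move=> i im; rewrite /Phi logit_iexp.
- apply: le_trans (le_iexp _ _).
  by rewrite -[X in X <= _]expr1 /Y ler_weXn2l.
Qed.

End iterated_exponential.

(** * Second order conditions and the barrier variable *)

Section second_order.
Variables (R : realType) (n : nat).
Notation pt := 'rV[R]_n.
Implicit Types (w : pt -> R) (x v : pt).

Definition C2_in_space w : Prop :=
  [/\ forall i y, derivable w y (evec R i),
      forall i, continuous (dx w i),
      forall i j y, derivable (dx w j) y (evec R i) &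
      forall i j, continuous (dx (dx w j) i)].

Lemma row_sum_evec v : v = \sum_i v ord0 i *: evec R i.
Proof. exact: row_sum_delta. Qed.

(** Additivity of strict derivatives in the direction yields the derivative along any [v] from
    continuous partial derivatives. *)
Lemma strict_derive_partials w x v :
  (forall i y, derivable w y (evec R i)) -> (forall i, {for x, continuous (dx w i)}) ->
  strict_derive w x v (\sum_i v ord0 i * dx w i x).
Proof.
move=> wd wc; rewrite {1}[v]row_sum_evec; apply: strict_derive_sum => i.
by apply: strict_deriveZ; apply: strict_derive_continuous; [exact: wd|exact: wc].
Qed.

Lemma dxdxC w i j x : C2_in_space w -> dx (dx w j) i x = dx (dx w i) j x.
Proof.
move=> [w1 _ w2 c2]; apply: (@schwarz _ _ w x (evec R j) (evec R i)) => //.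
  by apply: strict_derive_continuous; [exact: w2|exact: c2].
by apply: strict_derive_continuous; [exact: w2|exact: c2].
Qed.

(** One-variable test along the line through [x] in direction [v]: [g] is the derivative of the
    difference and [c] the derivative of [g] at [0]. *)
Lemma touching_from_below w x v (G G1 : R -> R) (G2 e : R) : C2_in_space w -> 0 < e ->
  (forall s : R, `|s| < e -> is_derive s 1 G (G1 s)) ->
  is_derive (0 : R) 1 G1 G2 ->
  (forall s : R, `|s| < e -> w (x + s *: v) - G s <= w x - G 0) ->
  \sum_i v ord0 i * dx w i x = G1 0 /\
  qform (fun i j => dx (dx w j) i x) (fun i => v ord0 i) <= G2.
Proof.
move=> [w1 c1 w2 c2] e0 GG1 G12 wmax.
pose g s := \sum_i v ord0 i * dx w i (x + s *: v) - G1 s.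
pose c := \sum_j v ord0 j * (\sum_i v ord0 i * dx (dx w j) i x) - G2.
have [||||] := @second_derivative_test _ (fun s => w (x + s *: v) - G s) g c e => //.
- move=> s se; apply: is_deriveB; last exact: GG1.
  apply: is_derive_line; apply: is_derive_strict; apply: strict_derive_partials => //.
  by move=> i; exact: c1.
- apply: is_deriveB => //.
  pose dv := fun y => \sum_j v ord0 j * dx w j y.
  apply: (@is_derive_line _ _ dv); rewrite scale0r addr0.
  have -> : dv = \sum_j (fun y => v ord0 j * dx w j y).
    by apply/funext => y; rewrite fct_sumE.
  apply: is_derive_sum => j; apply: (@is_deriveZ _ _ _ (dx w j)).
  apply: is_derive_strict; apply: strict_derive_partials => [i y|i]; first exact: w2.
  exact: c2.
- by move=> s /wmax; rewrite scale0r addr0.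
rewrite /g scale0r addr0 => /eqP; rewrite subr_eq0 => /eqP -> c0; split=> //.
have -> : qform (fun i j => dx (dx w j) i x) (fun i => v ord0 i) = c + G2; last lra.
rewrite /c subrK /qform exchange_big; apply: eq_bigr => j _ /=.
by rewrite mulr_sumr; apply: eq_bigr => i _; ring.
Qed.

End second_order.

Section barrier.
Variables (R : realType) (n : nat).
Notation pt := 'rV[R]_n.
Implicit Types x v : pt.

Definition sqnorm (x : pt) : R := \sum_(i < n) x ord0 i ^+ 2.

Lemma sqnorm_ge0 x : 0 <= sqnorm x.
Proof. by apply: sumr_ge0 => i _; exact: sqr_ge0. Qed.

Lemma enorm_le x (r : R) : 0 <= r -> (enorm x <= r) = (sqnorm x <= r ^+ 2).
Proof.
by move=> r0; rewrite -{1}[r](ger0_norm r0) -sqrtr_sqr ler_sqrt ?sqr_ge0.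
Qed.

Lemma coord_sqr_le x i : x ord0 i ^+ 2 <= sqnorm x.
Proof.
rewrite /sqnorm (bigD1 i)//= lerDl; apply: sumr_ge0 => j _; exact: sqr_ge0.
Qed.

Lemma sqnorm_continuous : continuous sqnorm.
Proof.
apply: continuous_big => [|i _]; first exact: add_continuous.
move=> x; apply: (cvg_comp _ (fun a : R => a ^+ 2)); first exact: coord_continuous.
exact: exprn_continuous.
Qed.

Lemma sqnorm_line x v (s : R) : sqnorm (x + s *: v) =
  sqnorm x + s * (2 * \sum_i x ord0 i * v ord0 i) + s ^+ 2 * sqnorm v.
Proof.
rewrite /sqnorm !mulr_sumr -!big_split; apply: eq_bigr => i _ /=.
by rewrite !mxE; ring.
Qed.

(* The variable [z] of the barrier; it vanishes for [|x| = r] and for [t = 0]. *)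
Definition zed (delta r : R) (x : pt) (t : R) : R :=
  delta * (1 - sqnorm x / r ^+ 2) * (1 - expR (- t)).

Lemma zed_continuous delta r : continuous (fun p : pt * R => zed delta r p.1 p.2).
Proof.
move=> p; apply: cvgM.
  apply: cvgM; first exact: cvg_cst.
  apply: cvgB; first exact: cvg_cst.
  apply: cvgM; last exact: cvg_cst.
  by apply: (cvg_comp _ _ (@cvg_fst _ _ _ _ _)); exact: sqnorm_continuous.
apply: cvgB; first exact: cvg_cst.
apply: (cvg_comp _ expR); last exact: continuous_expR.
by apply: cvgN; exact: cvg_snd.
Qed.

(** Without [0 <= t] the product could also be positive through two negative factors, outside the
    ball and at negative times. *)
Lemma zed_gt0P delta r x t : 0 < delta -> 0 < r -> 0 <= t -> 0 < zed delta r x t ->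
  0 < t /\ sqnorm x < r ^+ 2.
Proof.
move=> d0 r0 t0; rewrite /zed => z0.
have t1 : 0 < t.
  rewrite lt0r t0 andbT; apply/eqP => tE; move: z0.
  by rewrite tE oppr0 expR0 subrr mulr0 ltxx.
split=> //; have e0 : 0 < 1 - expR (- t) by rewrite subr_gt0 expR_lt1 oppr_lt0.
move: z0; rewrite pmulr_lgt0// pmulr_rgt0// subr_gt0 ltr_pdivrMr ?mul1r//.
by rewrite exprn_gt0.
Qed.

Lemma zed_itv delta r x t : 0 < delta -> 0 < r -> 0 < t -> sqnorm x < r ^+ 2 ->
  0 < zed delta r x t <= delta.
Proof.
move=> d0 r0 t0 xr.
have rr0 : 0 < r ^+ 2 by rewrite exprn_gt0.
have q0 : 0 < 1 - sqnorm x / r ^+ 2 by rewrite subr_gt0 ltr_pdivrMr ?mul1r.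
have q1 : 1 - sqnorm x / r ^+ 2 <= 1.
  by rewrite gerBl divr_ge0 ?sqnorm_ge0// ltW.
have e0 : 0 < 1 - expR (- t) by rewrite subr_gt0 expR_lt1 oppr_lt0.
have e1 : 1 - expR (- t) <= 1 by rewrite gerBl expR_ge0.
rewrite /zed !mulr_gt0//= -mulrA ler_piMr ?(ltW d0)//.
by apply: mulr_ile1 => //; exact: ltW.
Qed.

End barrier.

(** * Contact of a solution with the barrier *)

Lemma norm_sum_le (R : realType) (n : nat) (F : 'I_n -> R) (B : R) :
  (forall i, `|F i| <= B) -> `|\sum_i F i| <= n%:R * B.
Proof.
move=> FB; apply: (le_trans (ler_norm_sum _ _ _)).
by apply: (le_trans (ler_sum _ (fun i _ => FB i))); rewrite sumr_const card_ord mulr_natl.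
Qed.

Section solution.
Variables (R : realType) (n : nat).
Notation pt := 'rV[R]_n.
Implicit Types (u : pt -> R -> R) (x v : pt) (t : R).

Lemma within_time_slice (F : pt * R -> R) (t : R) : 0 < t ->
  {within [set p : pt * R | 0 < p.2], continuous F} ->
  continuous (fun y : pt => F (y, t)).
Proof.
move=> t0; rewrite continuous_open_subspace; last first.
  apply: (@open_comp _ _ (fun p : pt * R => p.2) [set s | 0 < s]).
    by move=> p _; exact: cvg_snd.
  exact: open_gt.
move=> Fc y.
have pair_cvg : (fun y' : pt => (y', t)) y' @[y' --> y] --> (y, t).
  apply: (@cvg_pair_nbhs R pt pt (nbhs y) (nbhs_filter y) id (cst t)).
    exact: cvg_id.
  exact: cvg_cst.
apply: (cvg_comp _ F pair_cvg).
by apply: Fc; rewrite inE.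
Qed.

Lemma C21_slice u t : 0 < t -> C21 u -> C2_in_space (fun y => u y t).
Proof.
move=> t0 [ud [_ [u1 u2]]]; split.
- by move=> i y; have [_ /(_ i)[]] := ud y t t0.
- by move=> i; exact: (within_time_slice t0 (u1 i)).
- by move=> i j y; have [_ /(_ i)[_]] := ud y t t0.
- by move=> i j; exact: (within_time_slice t0 (u2 i j)).
Qed.

Variables (Phi Phi1 Phi2 : R -> R) (delta r : R).
Hypotheses (delta01 : 0 < delta <= 1) (r1 : 1 <= r).
Hypothesis dPhi : forall z : R, 0 < z <= 1 -> is_derive z 1 Phi (Phi1 z).
Hypothesis dPhi1 : forall z : R, 0 < z <= 1 -> is_derive z 1 Phi1 (Phi2 z).

Let barr x t := Phi (zed delta r x t).

(** Along any line [zed] is a quadratic polynomial [l], so the one-variable test applies. Here [k]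
    is the factor [delta (1 - exp (-t))]; the gradient of [zed] is [- 2 k x / r^2], its Hessian is
    [- 2 k / r^2] times the identity, and the matrix subtracted from [dxx] is the Hessian of the
    barrier. *)
Lemma barrier_contact_space u x t : 0 < t -> C21 u ->
  (forall v, exists2 e : R, 0 < e & forall s : R, `|s| < e ->
     [/\ 0 < zed delta r (x + s *: v) t <= 1 &
      u (x + s *: v) t - barr (x + s *: v) t <= u x t - barr x t]) ->
  exists k : R, [/\ 0 <= k <= 1,
    forall i, dx (fun y => u y t) i x = - (2 * k * x ord0 i / r ^+ 2) * Phi1 (zed delta r x t) &
    forall v, qform (fun i j => dxx u i j x t -
      (Phi2 (zed delta r x t) * (2 * k / r ^+ 2) ^+ 2 * (x ord0 i * x ord0 j)
       - Phi1 (zed delta r x t) * (2 * k / r ^+ 2) * (i == j)%:R))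
      (fun i => v ord0 i) <= 0].
Proof.
move=> t0 uC umax.
pose k := delta * (1 - expR (- t)).
have e01 : 0 <= 1 - expR (- t) <= 1.
  by rewrite subr_ge0 -[X in _ <= X]expR0 ler_expR oppr_le0 (ltW t0)/= gerBl expR_ge0.
have k01 : 0 <= k <= 1.
  have /andP[d0 d1] := delta01; have /andP[e0 e1] := e01.
  by rewrite mulr_ge0//= ?(ltW d0)// mulr_ile1// ltW.
set z := zed delta r x t.
pose X v := \sum_i x ord0 i * v ord0 i.
have contact v : \sum_i v ord0 i * dx (fun y => u y t) i x =
    - (2 * k * X v / r ^+ 2) * Phi1 z /\
    qform (fun i j => dxx u i j x t) (fun i => v ord0 i) <=
    Phi2 z * (2 * k * X v / r ^+ 2) ^+ 2 - Phi1 z * (2 * k / r ^+ 2) * sqnorm v.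
  have [e e0 eP] := umax v.
  pose be := 2 * k * X v / r ^+ 2; pose ga := k / r ^+ 2 * sqnorm v.
  pose l (s : R) := z - be * s - ga * s ^+ 2.
  have lE s : zed delta r (x + s *: v) t = l s.
    by rewrite /l /z /zed sqnorm_line /be /ga /k -/(X v); ring.
  have l0 : l 0 = z by rewrite /l mulr0 expr0n mulr0 !subr0.
  have dl (s : R) : is_derive s 1 l (- be - ga * (2 * s)).
    apply: is_derive_eq; rewrite /GRing.scale /=; ring.
  pose G1 s := Phi1 (l s) * (- be - ga * (2 * s)).
  have lz (s : R) : `|s| < e -> 0 < l s <= 1 by move=> /eP[]; rewrite lE.
  have dG (s : R) : `|s| < e -> is_derive s 1 (Phi \o l) (G1 s).
    by move=> se; exact: (is_derive1_comp (dPhi (lz s se)) (dl s)).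
  have dG1 : is_derive (0 : R) 1 G1
      (Phi2 z * (- be) * (- be) + Phi1 z * (- (ga * 2))).
    have dl0 : is_derive (0 : R) 1 l (- be).
      by apply: is_derive_eq; rewrite mulr0 mulr0 subr0.
    have dP1 : is_derive (l 0) 1 Phi1 (Phi2 z).
      by rewrite -l0; apply: dPhi1; apply: lz; rewrite normr0.
    have B : is_derive (0 : R) 1 (fun s : R => - be - ga * (2 * s)) (- (ga * 2)).
      by apply: is_derive_eq; rewrite /GRing.scale /=; ring.
    have := is_deriveM (is_derive1_comp dP1 dl0) B => /is_derive_eq; apply.
    by rewrite /GRing.scale /= l0; ring.
  have wmax (s : R) : `|s| < e -> u (x + s *: v) t - (Phi \o l) s <= u x t - (Phi \o l) 0.
    by move=> /eP[_]; rewrite /barr lE -/z /= l0.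
  have [] := touching_from_below (C21_slice t0 uC) e0 dG dG1 wmax.
  rewrite /G1 l0 => E1 E2; split.
    by rewrite E1 /be; ring.
  apply: (le_trans E2); rewrite le_eqVlt; apply/orP; left; apply/eqP.
  by rewrite /be /ga; ring.
exists k; split=> // [i|v].
  have [+ _] := contact (evec R i).
  rewrite (bigD1 i)//= big1 => [|j ji]; last first.
    by rewrite /evec mxE eqxx /= (negbTE ji) mul0r.
  rewrite /X (bigD1 i)//= big1 => [|j ji]; last first.
    by rewrite /evec mxE eqxx /= (negbTE ji) mulr0.
  by rewrite /evec !mxE !eqxx /= !addr0 mul1r mulr1.
have [_] := contact v; rewrite -subr_le0 => /(le_trans _); apply.
rewrite le_eqVlt; apply/orP; left; apply/eqP.
have XE : X v ^+ 2 = \sum_i \sum_j (x ord0 i * x ord0 j) * v ord0 i * v ord0 j.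
  rewrite expr2 /X mulr_suml; apply: eq_bigr => i _; rewrite mulr_sumr.
  by apply: eq_bigr => j _; ring.
have nE : sqnorm v = \sum_i \sum_j (i == j)%:R * v ord0 i * v ord0 j.
  apply: eq_bigr => i _; rewrite (bigD1 i)//= big1 ?eqxx => [|j ji]; last first.
    by rewrite eq_sym (negbTE ji) !mul0r.
  by rewrite mul1r addr0 expr2.
have -> : Phi2 z * (2 * k * X v / r ^+ 2) ^+ 2 =
  Phi2 z * (2 * k / r ^+ 2) ^+ 2 * X v ^+ 2 by ring.
rewrite XE nE /qform !mulr_sumr -!sumrB; apply: eq_bigr => i _.
rewrite !mulr_sumr -!sumrB; apply: eq_bigr => j _; ring.
Qed.

(** Here [k] is the time derivative of [zed], namely [delta (1 - |x|^2/r^2) exp (-t)]. *)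
Lemma barrier_contact_time u x t : 0 < t -> sqnorm x < r ^+ 2 -> C21 u ->
  (exists2 e : R, 0 < e & forall s : R, t - e < s < t ->
     u x s - barr x s <= u x t - barr x t) ->
  exists2 k : R, 0 <= k <= 1 & Phi1 (zed delta r x t) * k <= dt u x t.
Proof.
move=> t0 xr uC [e e0 umax].
have /andP[d0 d1] := delta01; have r0 : 0 < r := lt_le_trans ltr01 r1.
have rr0 : 0 < r ^+ 2 by rewrite exprn_gt0.
pose q := 1 - sqnorm x / r ^+ 2.
have q0 : 0 <= q <= 1.
  rewrite /q subr_ge0 ler_pdivrMr// mul1r (ltW xr)/= gerBl.
  by rewrite divr_ge0 ?sqnorm_ge0// ltW.
have z01 : 0 < zed delta r x t <= 1.
  have /andP[-> /le_trans->] := zed_itv d0 r0 t0 xr => //.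
exists (delta * q * expR (- t)).
  have /andP[q00 q1] := q0.
  rewrite mulr_ge0 ?expR_ge0//=; last by rewrite mulr_ge0// ltW.
  rewrite mulr_ile1 ?expR_ge0//; [by rewrite mulr_ge0// ltW|by rewrite mulr_ile1// ltW|].
  by rewrite -[X in _ <= X]expR0 ler_expR oppr_le0 ltW.
have dz : is_derive t 1 (zed delta r x) (delta * q * expR (- t)).
  have dN : is_derive t 1 (-%R : R -> R) (- 1) by exact: is_deriveNid.
  have dE := @is_derive1_comp _ expR -%R t _ _ (is_derive_expR (- t)) dN.
  have := is_deriveZ (delta * q) (is_deriveB (is_derive_cst (1 : R) t 1) dE).
  by move=> /is_derive_eq; apply; rewrite /GRing.scale /=; ring.
have db := @is_derive1_comp _ Phi (zed delta r x) t _ _ (dPhi z01) dz.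
have du : is_derive t 1 (fun s => u x s) (dt u x t).
  by apply: DeriveDef => //; have [/(_ x t t0)[]] := uC.
have := derive_ge0_at_left_max e0 (is_deriveB du db) umax.
by rewrite subr_ge0.
Qed.

End solution.

(** * Comparison *)

Section comparison.
Variables (R : realType) (n : nat).
Notation pt := 'rV[R]_n.
Variables (a : 'I_n -> 'I_n -> pt -> R) (b : 'I_n -> pt -> R) (f : pt -> R -> R).
Variables (Phi Phi1 Phi2 : R -> R) (delta r A : R).
Hypotheses (delta01 : 0 < delta <= 1) (r1 : 1 <= r) (A0 : 0 <= A).
Hypothesis dPhi : forall z : R, 0 < z <= 1 -> is_derive z 1 Phi (Phi1 z).
Hypothesis dPhi1 : forall z : R, 0 < z <= 1 -> is_derive z 1 Phi1 (Phi2 z).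
Hypothesis ell : elliptic a.
Hypothesis aA : forall i j x, sqnorm x <= r ^+ 2 -> `|a i j x| <= A.
Hypothesis bA : forall i x, sqnorm x <= r ^+ 2 -> `|b i x| <= A.

Let barr (x : pt) (t : R) := Phi (zed delta r x t).
(* The entries of the Hessian of [Phi (z)] are at most [6 B] and those of its
   gradient at most [2 B] when [|Phi'|] and [|Phi''|] are at most [B]. *)
Let kappa : R := (n%:R * n%:R * 6 + n%:R * 2) * A + 1.

(** The equation gives [f = u_t - L u]. At the contact [u_t] is at least the time derivative of the
    barrier, the gradients agree, and the trace inequality bounds the second order part of [L u] by
    that of the barrier. *)
Lemma barrier_contact_reaction g u (x : pt) (t B : R) :
  is_solution a b f g u -> 0 < t -> sqnorm x < r ^+ 2 ->
  `|Phi1 (zed delta r x t)| <= B -> `|Phi2 (zed delta r x t)| <= B ->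
  (forall v, exists2 e : R, 0 < e & forall s : R, `|s| < e ->
     [/\ 0 < zed delta r (x + s *: v) t <= 1 &
      u (x + s *: v) t - barr (x + s *: v) t <= u x t - barr x t]) ->
  (exists2 e : R, 0 < e & forall s : R, t - e < s < t ->
     u x s - barr x s <= u x t - barr x t) ->
  - (kappa * B) <= f x (u x t).
Proof.
move=> [uC [_ [eqn _]]] t0 xr P1B P2B maxx maxt.
have [k [k01 Dx Hx]] := barrier_contact_space delta01 dPhi dPhi1 t0 uC maxx.
have [k' k'01 Dt] := barrier_contact_time delta01 r1 dPhi t0 xr uC maxt.
set z := zed delta r x t in P1B P2B Dx Hx Dt *.
have B0 : 0 <= B := le_trans (normr_ge0 _) P1B.
have r0 : 0 < r := lt_le_trans ltr01 r1.
have rr1 : 1 <= r ^+ 2 by rewrite exprn_ege1.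
have rr0 : 0 < r ^+ 2 := lt_le_trans ltr01 rr1.
have /andP[k0 k1] := k01.
have xi i : `|x ord0 i| <= r.
  rewrite -[r]ger0_norm ?(ltW r0)// -ler_sqr ?nnegrE// -!normrX.
  rewrite !ger0_norm ?sqr_ge0//; exact: le_trans (coord_sqr_le _ _) (ltW xr).
have kr0 : 0 <= 2 * k / r ^+ 2 by rewrite !mulr_ge0// invr_ge0 ltW.
(* The assumption [1 <= r] makes these two bounds independent of [r]. *)
have kr2 : 2 * k / r ^+ 2 <= 2.
  rewrite ler_pdivrMr//; nra.
have kr : 2 * k / r ^+ 2 * r <= 2.
  rewrite mulrAC ler_pdivrMr// expr2; nra.
(* Hessian of the barrier: the rank-one part contributes at most [4 B] to an entry and the diagonal
   part at most [2 B]. *)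
pose Bm i j := Phi2 z * (2 * k / r ^+ 2) ^+ 2 * (x ord0 i * x ord0 j)
       - Phi1 z * (2 * k / r ^+ 2) * (i == j)%:R.
have BmB i j : `|Bm i j| <= 6 * B.
  have -> : 6 * B = B * (2 * 2) + B * 2 by ring.
  apply: le_trans (ler_normB _ _) (lerD _ _).
    rewrite -mulrA normrM ler_pM// expr2.
    have -> : 2 * k / r ^+ 2 * (2 * k / r ^+ 2) * (x ord0 i * x ord0 j) =
      (2 * k / r ^+ 2 * x ord0 i) * (2 * k / r ^+ 2 * x ord0 j) by ring.
    have kx l : `|2 * k / r ^+ 2 * x ord0 l| <= 2.
      rewrite normrM (ger0_norm kr0); apply: le_trans kr.
      by rewrite ler_wpM2l.
    by rewrite normrM ler_pM.
  rewrite -mulrA normrM ler_pM// normrM (ger0_norm kr0) normr_nat.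
  by case: (i == j); rewrite ?mulr1 ?mulr0.
have trace : \sum_i \sum_j a i j x * (dxx u i j x t - Bm i j) <= 0.
  apply: elliptic_trace_le0 => [v|i j|v].
  - have [v0|v0] := eqVneq (\row_i v i : pt) 0.
      rewrite /qform big1// => i _; rewrite big1// => j _.
      have -> : v i = (\row_i v i : pt) ord0 i by rewrite mxE.
      by rewrite v0 mxE mulr0 mul0r.
    apply: ltW; have := ell x v0; congr (0 < _).
    by apply: eq_bigr => i _; apply: eq_bigr => j _; rewrite !mxE.
  - rewrite /dxx (dxdxC _ _ _ (C21_slice t0 uC)) /Bm [x ord0 i * _]mulrC.
    by rewrite (eq_sym i j).
  - have := Hx (\row_i v i); congr (_ <= 0).
    by apply: eq_bigr => i _; apply: eq_bigr => j _; rewrite !mxE.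
have aH : \sum_i \sum_j a i j x * dxx u i j x t <= n%:R * (n%:R * (A * (6 * B))).
  have -> : \sum_i \sum_j a i j x * dxx u i j x t =
      \sum_i \sum_j a i j x * (dxx u i j x t - Bm i j) +
      \sum_i \sum_j a i j x * Bm i j.
    rewrite -big_split; apply: eq_bigr => i _ /=; rewrite -big_split.
    by apply: eq_bigr => j _ /=; ring.
  have : `|\sum_i \sum_j a i j x * Bm i j| <= n%:R * (n%:R * (A * (6 * B))).
    apply: norm_sum_le => i; apply: norm_sum_le => j; rewrite normrM ler_pM//.
    by apply: aA; exact: ltW.
  by rewrite ler_norml => /andP[_ aB]; lra.
have bD : \sum_i b i x * dx (fun y => u y t) i x <= n%:R * (A * (2 * B)).
  have : `|\sum_i b i x * dx (fun y => u y t) i x| <= n%:R * (A * (2 * B)).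
    apply: norm_sum_le => i; rewrite normrM ler_pM//; first by apply: bA; exact: ltW.
    rewrite Dx normrM normrN ler_pM//.
    have -> : 2 * k * x ord0 i / r ^+ 2 = 2 * k / r ^+ 2 * x ord0 i by ring.
    rewrite normrM (ger0_norm kr0); apply: le_trans kr.
    by rewrite ler_wpM2l.
  by rewrite ler_norml => /andP[].
have P1k : - B <= Phi1 z * k'.
  have /andP[k'0 k'1] := k'01.
  have : `|Phi1 z * k'| <= B.
    by rewrite normrM -[B]mulr1 ler_pM// ger0_norm.
  by rewrite ler_norml => /andP[].
move: Dt; rewrite eqn// /Lop => Dt.
have -> : kappa * B = n%:R * (n%:R * (A * (6 * B))) + n%:R * (A * (2 * B)) + B.
  by rewrite /kappa; ring.
by lra.
Qed.

(** The barrier is infinite on the parabolic boundary, so the difference is maximised on a compact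
    set [K] cut out by [eta <= zed], with [eta] so small that the maximum cannot lie on the cut. *)
Lemma barrier_comparison (m : nat) (eps C : R) g u :
  0 < eps ->
  (forall z : R, 0 < z <= 1 ->
    [/\ `|Phi1 z| <= C * absorption m eps (Phi z),
        `|Phi2 z| <= C * absorption m eps (Phi z),
        forall i, (i <= m.+1)%N -> 1 <= logit i (Phi z) & z^-1 <= Phi z]) ->
  (forall x v, sqnorm x <= r ^+ 2 -> delta^-1 <= v ->
    f x v < - (kappa * C * absorption m eps v)) ->
  is_solution a b f g u ->
  forall (x : pt) (t : R), 0 < t -> sqnorm x < r ^+ 2 -> u x t <= barr x t.
Proof.
move=> eps0 prof fneg sol x1 t1 t10 x1r; rewrite leNgt; apply/negP => contra.
have [d0 d1] := andP delta01.
have r0 : 0 < r := lt_le_trans ltr01 r1.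
have zle1 (x : pt) (t : R) : 0 < t -> sqnorm x < r ^+ 2 -> 0 < zed delta r x t <= 1.
  by move=> t0 xr; have /andP[-> /le_trans->] := zed_itv d0 r0 t0 xr.
(* A cube times a time interval, compact as a product and containing the part of the cylinder up to
   time [t1]. *)
pose box : set (pt * R) := [set x : pt | forall i, `[- r, r]%classic (x ord0 i)] `*` `[0, t1]%classic.
have box_compact : compact box.
  apply: compact_setX; last exact: segment_compact.
  by apply: (@rV_compact _ _ (fun=> `[- r, r]%classic)) => i; exact: segment_compact.
have inbox (x : pt) (t : R) : sqnorm x < r ^+ 2 -> 0 <= t <= t1 -> box (x, t).
  move=> xr tt; split=> /= [i|]; rewrite in_itv//=.
  rewrite -ler_norml -[r]ger0_norm ?(ltW r0)// -ler_sqr ?nnegrE// -!normrX.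
  rewrite !ger0_norm ?sqr_ge0//; exact: le_trans (coord_sqr_le _ _) (ltW xr).
have [uC [u_cont _]] := sol.
have u_box : {within box, continuous (fun p => u p.1 p.2)}.
  apply: continuous_subspaceW u_cont => p [_ /=]; rewrite in_itv/=.
  by case/andP.
have p1box : box (x1, t1) by apply: inbox => //; rewrite ltW/=.
have [pU _ pUmax] := compact_EVT_max (ex_intro _ _ p1box) box_compact u_box.
pose U := u pU.1 pU.2.
have uU p : box p -> u p.1 p.2 <= U by move=> bp; apply: pUmax; rewrite inE.
pose z1 := zed delta r x1 t1.
have z10 : 0 < z1 by have /andP[] := zle1 x1 t1 t10 x1r.
have U2 : 0 < `|U| + 2 by rewrite ltr_wpDl.
(* The bound by [z1] puts [(x1, t1)] in [K]. Where [zed] is positive and at most the other bound,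
   the barrier is at least [|U| + 2] and exceeds [u]. *)
pose eta := Num.min z1 (`|U| + 2)^-1.
have eta0 : 0 < eta by rewrite lt_min z10 invr_gt0.
have [etaz etaU] : eta <= z1 /\ eta <= (`|U| + 2)^-1.
  by rewrite /eta !ge_min !lexx orbT.
pose K := box `&` [set p | eta <= zed delta r p.1 p.2].
have K_compact : compact K.
  apply: compact_closedI => //.
  apply: (@closed_comp _ _ (fun p : pt * R => zed delta r p.1 p.2) [set z | eta <= z]).
    by move=> p _; exact: zed_continuous.
  exact: closed_ge.
have Kpos p : K p -> [/\ 0 < p.2, p.2 <= t1 & sqnorm p.1 < r ^+ 2].
  case=> -[_ /=]; rewrite in_itv/= => /andP[p20 p2t] zp.
  by have [] := zed_gt0P d0 r0 p20 (lt_le_trans eta0 zp).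
have w_cont : {within K, continuous (fun p => u p.1 p.2 - barr p.1 p.2)}.
  have uK : {within K, continuous (fun p => u p.1 p.2)}.
    by apply: continuous_subspaceW u_box => p [].
  have bK : {within K, continuous (fun p => barr p.1 p.2)}.
    apply: continuous_in_subspaceT => p; rewrite inE => Kp.
    have [p20 _ p1r] := Kpos p Kp.
    apply: (@continuous_comp _ _ _ (fun p : pt * R => zed delta r p.1 p.2) Phi).
      exact: zed_continuous.
    have [dP _] := dPhi (zle1 _ _ p20 p1r).
    by apply: differentiable_continuous; apply/derivable1_diffP.
  by move=> p; apply: cvgB; [exact: uK|exact: bK].
have K1 : K (x1, t1) by [].
have [[xm tm]] := compact_EVT_max (ex_intro _ _ K1) K_compact w_cont.
rewrite inE => Km wmax.
have {}wmax p : K p -> u p.1 p.2 - barr p.1 p.2 <= u xm tm - barr xm tm.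
  by move=> Kp; apply: wmax; rewrite inE.
have [/= tm0 tm1 xmr] := Kpos _ Km.
have above : barr xm tm < u xm tm by have /= := wmax _ K1; lra.
have zm01 := zle1 _ _ tm0 xmr; have /andP[zm0 zm1] := zm01.
have [P1 P2 Plog Pinv] := prof _ zm01.
set zm := zed delta r xm tm in zm01 zm0 zm1 P1 P2 Plog Pinv.
(* Strictness matters: nearby points of the test line, and nearby earlier times, still satisfy
   [eta < zed] and hence belong to [K]. *)
have zm_eta : eta < zm.
  apply: le_lt_trans etaU _; rewrite -[zm]invrK ltf_pV2 ?posrE ?invr_gt0//.
  apply: le_lt_trans Pinv _; apply: lt_le_trans above _.
  by apply: (le_trans (uU _ Km.1)); rewrite (le_trans (ler_norm _))// lerDl.
have near_zm (gam : R -> pt * R) (s0 : R) : gam s0 = (xm, tm) ->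
    {for s0, continuous gam} ->
    exists2 e : R, 0 < e & forall s : R, `|s - s0| < e ->
      eta < zed delta r (gam s).1 (gam s).2.
  move=> gE gc.
  have zc : zed delta r (gam s).1 (gam s).2 @[s --> s0] --> zm.
    rewrite /zm -[xm]/(xm, tm).1 -[tm in X in _ --> X]/(xm, tm).2 -gE.
    exact: (cvg_comp gam _ gc (@zed_continuous _ _ delta r (gam s0))).
  move: zc => /cvgr_gt /(_ _ zm_eta) /nbhs_ballP [e /= e0 eP].
  exists e => // s se; apply: eP; rewrite /ball /= /ball_ distrC; exact: se.
have react := @barrier_contact_reaction g u xm tm _ sol tm0 xmr P1 P2.
have := fneg xm (u xm tm) (ltW xmr).
have h_mono := absorption_mono (ltW eps0) Plog (ltW above).
have /andP[h0 hle] := h_mono.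
have C0 : 0 <= C.
  by have := le_trans (normr_ge0 _) P1; rewrite pmulr_lge0.
have kap0 : 0 <= kappa by rewrite addr_ge0// mulr_ge0// addr_ge0// !mulr_ge0.
have hK : kappa * C * absorption m eps (Phi zm) <= kappa * C * absorption m eps (u xm tm).
  by rewrite ler_wpM2l// mulr_ge0.
(* Since [zed] never exceeds [delta] in the cylinder, a small [delta] forces [u] to be large at the
   contact, in the range where [fneg] applies. *)
have dinv : delta^-1 <= u xm tm.
  apply: le_trans (ltW above); apply: le_trans Pinv.
  by rewrite lef_pV2 ?posrE//; have /andP[] := zed_itv d0 r0 tm0 xmr.
suff : - (kappa * (C * absorption m eps (Phi zm))) <= f xm (u xm tm).
  by rewrite mulrA => A1 /(_ dinv); lra.
apply: react => [v|].
  have [||e e0 eP] := near_zm (fun s => (xm + s *: v, tm)) 0.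
  - by rewrite scale0r addr0.
  - apply: cvg_pair_nbhs; last exact: cvg_cst.
    apply: cvgD; first exact: cvg_cst.
    by apply: cvgZr_tmp; exact: cvg_id.
  exists e => // s se; have /= etas := eP s _; rewrite subr0 in etas.
  have {}etas := etas se.
  have [_ xsr] := zed_gt0P d0 r0 (ltW tm0) (lt_trans eta0 etas).
  split; first exact: zle1.
  apply: (wmax (_, _)); split=> /=; last exact: ltW.
  by apply: inbox => //; rewrite (ltW tm0).
have [||e e0 eP] := near_zm (fun s => (xm, s)) tm => //.
  by apply: cvg_pair_nbhs; [exact: cvg_cst|exact: cvg_id].
(* Cutting at [tm] keeps the compared times positive. *)
exists (Num.min e tm) => [|s /andP[s0 s1]]; first by rewrite lt_min e0.
have [me mt] : Num.min e tm <= e /\ Num.min e tm <= tm by rewrite !ge_min !lexx orbT.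
apply: (wmax (_, _)); split=> /=; last first.
  by apply: ltW; apply: (eP s); rewrite ltr0_norm; lra.
by apply: inbox => //; apply/andP; split; lra.
Qed.

End comparison.

(** * Universal bounds *)

Section local_bound.
Variables (R : realType) (n : nat).
Notation pt := 'rV[R]_n.

Lemma enorm0 : enorm (0 : pt) = 0.
Proof. by rewrite /enorm big1 ?sqrtr0// => i _; rewrite mxE expr0n. Qed.

(** [sup] is an upper bound only for a set bounded above; the Lipschitz estimate against the point
    [0] supplies this. The radius [r + v] accommodates both [x] and [v]. *)
Lemma le_FR (f : pt -> R -> R) (r v : R) (x : pt) :
  locally_lipschitz f -> 0 < r -> 0 <= v -> enorm x <= r -> f x v <= FR f r v.
Proof.
move=> flip r0 v0 xr.
have rv0 : 0 < r + v by rewrite ltr_wpDr.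
have [K KP] := flip _ rv0.
apply: ub_le_sup; last by exists x.
exists (f 0 v + `|K| * r) => _ [y /= yr <-].
have yrv : enorm y <= r + v by rewrite (le_trans yr)// lerDl.
have vrv : 0 <= v <= r + v by rewrite v0 lerDr ltW.
have := KP y 0 v v yrv; rewrite enorm0 => /(_ (ltW rv0) vrv vrv).
rewrite subr0 subrr normr0 addr0 -lerBlDl => yK.
apply: le_trans (ler_norm _) (le_trans yK _).
apply: (le_trans (ler_norm _)); rewrite normrM ler_wpM2l//.
by rewrite ger0_norm// sqrtr_ge0.
Qed.

Lemma locally_holder_bounded (alpha : R) (h : pt -> R) (r : R) :
  0 < alpha -> locally_holder alpha h -> 0 < r ->
  exists2 A : R, 0 <= A & forall x, sqnorm x <= r ^+ 2 -> `|h x| <= A.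
Proof.
move=> al0 hh r0; have [C CP] := hh r r0.
exists (`|h 0| + `|C| * powR r alpha) => [|x].
  by rewrite addr_ge0// mulr_ge0// powR_ge0.
rewrite -enorm_le ?(ltW r0)// => xr.
have := CP x 0 xr; rewrite enorm0 subr0 => /(_ (ltW r0)) hx.
have -> : h x = h 0 + (h x - h 0) by ring.
apply: le_trans (ler_normD _ _) _; rewrite lerD2l (le_trans hx)//.
apply: (le_trans (ler_norm _)); rewrite normrM ler_wpM2l// ger0_norm ?powR_ge0//.
by apply: ge0_ler_powR; rewrite ?nnegrE ?sqrtr_ge0// ltW.
Qed.

Lemma finite_common_bound (I : finType) (T : Type) (P : T -> Prop) (h : I -> T -> R) :
  (forall i, exists2 A : R, 0 <= A & forall x, P x -> `|h i x| <= A) ->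
  exists2 A : R, 0 <= A & forall i x, P x -> `|h i x| <= A.
Proof.
move=> hb.
have /choice[A AP] : forall i, exists A : R, 0 <= A /\ forall x, P x -> `|h i x| <= A.
  by move=> i; have [A A0 AP] := hb i; exists A.
exists (\sum_i A i) => [|i x Px].
  by apply: sumr_ge0 => i _; have [] := AP i.
have [_ /(_ x Px) hA] := AP i; apply: (le_trans hA).
by rewrite (bigD1 i)//= lerDl; apply: sumr_ge0 => j _; have [] := AP j.
Qed.

Variables (alpha : R) (a : 'I_n -> 'I_n -> pt -> R) (b : 'I_n -> pt -> R).
Variable (f : pt -> R -> R).
Hypothesis alpha0 : 0 < alpha.
Hypothesis a_holder : forall i j, locally_holder alpha (a i j).
Hypothesis b_holder : forall i, locally_holder alpha (b i).
Hypothesis ell : elliptic a.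
Hypothesis f_lip : locally_lipschitz f.
Hypothesis f_F2 : cond_F2 f.

(** On the smaller cylinder [zed] stays in [[z0, 1]] with [z0 > 0], where the continuous [Phi] has a
    maximum. Neither [z0] nor [Phi] depends on [g] or [u]. *)
Lemma local_universal_bound (r : R) : 1 <= r ->
  exists C : R, forall g u, is_solution a b f g u ->
    forall (x : pt) (t : R), sqnorm x <= r ^+ 2 / 4 -> r^-1 <= t -> u x t <= C.
Proof.
move=> r1; have r0 : 0 < r := lt_le_trans ltr01 r1.
have [m [eps [eps0 lim]]] := f_F2 r0.
have [Phi [Phi1 [Phi2 [C prof]]]] := barrier_profile m eps0.
have [A A0 [aA bA]] : exists2 A : R, 0 <= A &
    (forall i j (x : pt), sqnorm x <= r ^+ 2 -> `|a i j x| <= A) /\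
    (forall i (x : pt), sqnorm x <= r ^+ 2 -> `|b i x| <= A).
  have [A1 A10 A1P] := @finite_common_bound ('I_n * 'I_n)%type pt
    (fun x => sqnorm x <= r ^+ 2) (fun ij => a ij.1 ij.2)
    (fun ij => locally_holder_bounded alpha0 (a_holder ij.1 ij.2) r0).
  have [A2 A20 A2P] := @finite_common_bound 'I_n pt
    (fun x => sqnorm x <= r ^+ 2) b
    (fun i => locally_holder_bounded alpha0 (b_holder i) r0).
  exists (A1 + A2); first by rewrite addr_ge0.
  split=> [i j x xr|i x xr].
    by apply: (le_trans (A1P (i, j) x xr)); rewrite lerDl.
  by apply: (le_trans (A2P i x xr)); rewrite lerDr.
pose kappa : R := (n%:R * n%:R * 6 + n%:R * 2) * A + 1.
have [W0 [_ W0P]] := cvgrNy_lt lim (- (kappa * C)).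
(* [D] is the inverse of [delta]: at least [1] so that [delta <= 1], beyond the threshold [W0] of
   (F-2), and at least [Phi 1] so that [absorption] is positive and can be multiplied out. *)
pose D := 1 + `|W0| + `|Phi 1|.
have D1 : 1 <= D by rewrite /D -addrA lerDl addr_ge0.
have D0 : 0 < D := lt_le_trans ltr01 D1.
have delta01 : 0 < D^-1 <= 1 by rewrite invr_gt0 D0 invf_le1.
have one01 : 0 < (1 : R) <= 1 by rewrite ltr01 lexx.
have [_ _ _ log1 _] := prof 1 one01.
have fneg (x : pt) (v : R) : sqnorm x <= r ^+ 2 -> D^-1^-1 <= v ->
    f x v < - (kappa * C * absorption m eps v).
  rewrite invrK => xr Dv.
  have [W0v Pv] : W0 < v /\ Phi 1 <= v.
    have := ler_norm W0; have := ler_norm (Phi 1).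
    have := normr_ge0 W0; have := normr_ge0 (Phi 1).
    by move: Dv; rewrite /D; lra.
  have v0 : 0 <= v := le_trans (ltW D0) Dv.
  have /andP[h0 hle] := absorption_mono (ltW eps0) log1 Pv.
  have hv := lt_le_trans h0 hle.
  have := W0P v W0v; rewrite -/(absorption m eps v) ltr_pdivrMr// mulNr.
  by apply: le_lt_trans; apply: le_FR => //; rewrite enorm_le// ltW.
have dPhi (z : R) : 0 < z <= 1 -> is_derive z 1 Phi (Phi1 z) by case/prof.
have dPhi1 (z : R) : 0 < z <= 1 -> is_derive z 1 Phi1 (Phi2 z) by case/prof.
have prof' (z : R) : 0 < z <= 1 ->
    [/\ `|Phi1 z| <= C * absorption m eps (Phi z),
        `|Phi2 z| <= C * absorption m eps (Phi z),
        forall i, (i <= m.+1)%N -> 1 <= logit i (Phi z) & z^-1 <= Phi z].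
  by case/prof=> _ _ [].
have e0 : 0 < 1 - expR (- r^-1) by rewrite subr_gt0 expR_lt1 oppr_lt0 invr_gt0.
have e1 : 1 - expR (- r^-1) <= 1 by rewrite gerBl expR_ge0.
(* The factor [3 / 4] is the least value of [1 - |x|^2/r^2] allowed by [sqnorm x <= r ^+ 2 / 4]. *)
pose z0 := D^-1 * (3 / 4) * (1 - expR (- r^-1)).
have /andP[Di0 Di1] := delta01.
have q34 : 0 < (3 / 4 : R) <= 1 by apply/andP; split; lra.
have /andP[q0 q1] := q34.
have z00 : 0 < z0 by rewrite !mulr_gt0.
have z01 : z0 <= 1.
  apply: mulr_ile1; rewrite ?(ltW e0)//; first by rewrite mulr_ge0// ltW.
  by apply: mulr_ile1; rewrite ?(ltW Di0) ?(ltW q0).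
have Phic : {within `[z0, 1], continuous Phi}.
  apply: derivable_within_continuous => z; rewrite in_itv/= => /andP[z0z z1].
  by have [] := dPhi z; rewrite ?(lt_le_trans z00 z0z).
have [zM _ zMmax] := EVT_max z01 Phic.
exists (Phi zM) => g u sol x t xr tr.
have rr0 : 0 < r ^+ 2 by rewrite exprn_gt0.
have t0 : 0 < t by apply: lt_le_trans tr; rewrite invr_gt0.
have xr' : sqnorm x < r ^+ 2 by lra.
apply: le_trans (barrier_comparison delta01 r1 A0 dPhi dPhi1 ell aA bA eps0 prof'
  fneg sol t0 xr') _.
apply: zMmax; rewrite in_itv/=.
have /andP[_ zD] := zed_itv Di0 r0 t0 xr'.
rewrite (le_trans zD)// andbT /z0 /zed.
rewrite ler_pM ?(ltW e0) ?mulr_ge0 ?(ltW Di0) ?(ltW q0)//.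
  rewrite ler_pM2l// lerBrDr -lerBrDl ler_pdivrMr//; lra.
by rewrite lerD2l lerN2 ler_expR lerN2.
Qed.

End local_bound.

(** Locally finite sum of ramps: [term k] vanishes for [s <= k - 1] and is at least [|C k|] for
    [s >= k]. The number of summands jumps with [s], but [cE] shows that any sufficiently large
    number gives the same sum. *)
Lemma continuous_majorant (R : realType) (C : nat -> R) :
  exists c : R -> R, continuous c /\
    forall (s : R) (N : nat), 0 <= s -> N%:R <= s -> C N <= c s.
Proof.
pose term k (s : R) := `|C k| * Num.max 0 (s - k%:R + 1).
pose c s := \sum_(k < (Num.truncn s).+3) term k s.
have term0 k (s : R) : s + 1 <= k%:R -> term k s = 0.
  by move=> sk; rewrite /term max_l ?mulr0//; lra.
have termC k : continuous (term k).
  move=> s; apply: cvgM; first exact: cvg_cst.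
  apply: (@continuous_max _ _ (cst 0) (fun s : R => s - k%:R + 1)).
    exact: cvg_cst.
  apply: cvgD; last exact: cvg_cst.
  by apply: cvgB; [exact: cvg_id|exact: cvg_cst].
have cE (K : nat) (s : R) : s + 1 <= K%:R -> c s = \sum_(k < K) term k s.
  move=> sK.
  have widen p q : s + 1 <= p%:R -> (p <= q)%N ->
      \sum_(k < q) term k s = \sum_(k < p) term k s.
    move=> sp pq; rewrite -(subnKC pq) big_split_ord /= [X in _ + X]big1 ?addr0//.
    by move=> i _; rewrite term0// (le_trans sp)// ler_nat leq_addr.
  have st : s + 1 <= (Num.truncn s).+3%:R.
    have := truncnS_gt s; rewrite -[_.+3%:R]natr1 -[_.+2%:R]natr1 => H; lra.
  rewrite /c; have [Kt|tK] := leqP K (Num.truncn s).+3; first exact: widen.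
  by rewrite (widen _ _ st (ltnW tK)).
exists c; split=> [s|s N s0 Ns].
  pose K := (Num.truncn s).+3.
  (* The margin [2] lets the same [K] serve all points at distance less than [1] from [s], so [c] is
     a fixed finite sum there. *)
  have sK : s + 2 < K%:R.
    by have := truncnS_gt s; rewrite /K -[_.+3%:R]natr1 -[_.+2%:R]natr1; lra.
  have cK : continuous (fun s : R => \sum_(k < K) term k s).
    by apply: continuous_big => [|k _]; [exact: add_continuous|exact: termC].
  apply: (@cvg_trans _ ((fun s : R => \sum_(k < K) term k s) @ s)); last first.
    by rewrite (cE K); [exact: cK|lra].
  apply: near_eq_cvg; exists 1 => //= y; rewrite /ball_ /= => sy.
  rewrite (cE K)//; move: sy; rewrite ltr_norml => /andP[]; lra.
have Nt : (N < (Num.truncn s).+3)%N.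
  by rewrite -(ltr_nat R); have := truncnS_gt s;
     rewrite -[_.+3%:R]natr1 -[_.+2%:R]natr1; lra.
rewrite /c (bigD1 (Ordinal Nt))//=.
have : 0 <= \sum_(i < (Num.truncn s).+3 | i != Ordinal Nt) term i s.
  by apply: sumr_ge0 => i _; rewrite mulr_ge0// le_max lexx.
have : C N <= term N s.
  rewrite (le_trans (ler_norm _))// /term ler_peMr// le_max.
  by apply/orP; right; lra.
by lra.
Qed.

Theorem theorem1 (R : realType) (n : nat) (alpha : R)
  (a : 'I_n -> 'I_n -> 'rV[R]_n -> R) (b : 'I_n -> 'rV[R]_n -> R)
  (f : 'rV[R]_n -> R -> R) :
  0 < alpha < 1 ->
  (forall i j : 'I_n, locally_holder alpha (a i j)) ->
  (forall i : 'I_n, locally_holder alpha (b i)) ->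
  elliptic a ->
  locally_lipschitz f ->
  cond_F1 f -> cond_F2 f ->
  exists M : 'rV[R]_n -> R -> R,
    {within [set p : 'rV[R]_n * R | 0 < p.2], continuous (fun p => M p.1 p.2)} /\
    forall (g : 'rV[R]_n -> R) (u : 'rV[R]_n -> R -> R),
      continuous g -> (forall x, 0 <= g x) ->
      is_solution a b f g u ->
      forall (x : 'rV[R]_n) (t : R), 0 < t -> u x t <= M x t.
Proof.
move=> /andP[al0 _] ah bh ell flip _ fF2.
have /choice[C CP] : forall N : nat, exists C : R, forall g u,
    is_solution a b f g u -> forall (x : 'rV[R]_n) (t : R),
    (1 <= N)%N -> sqnorm x <= N%:R ^+ 2 / 4 -> N%:R^-1 <= t -> u x t <= C.
  (* For [N = 0] the condition [1 <= N] fails and any value will do. *)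
  case=> [|N]; first by exists 0.
  have N1 : 1 <= N.+1%:R :> R by rewrite ler1n.
  have [C CP] := local_universal_bound al0 ah bh ell flip fF2 N1.
  by exists C => g u sol x t _; exact: (CP g u sol).
have [c [c_cont cC]] := continuous_majorant C.
(* The final [1] absorbs the rounding: the integer part [N] of [S x t] exceeds both [2 (1 + |x|^2)]
   and [1/t], so [|x|^2 <= N^2/4] and [1/N <= t]. *)
pose S (x : 'rV[R]_n) (t : R) := 2 * (1 + sqnorm x) + t^-1 + 1.
exists (fun x t => c (S x t)); split.
  apply: continuous_in_subspaceT => p; rewrite inE /= => p0.
  apply: (@continuous_comp _ _ _ (fun p : 'rV[R]_n * R => S p.1 p.2) c);
    last exact: c_cont.
  apply: cvgD; last exact: cvg_cst.
  apply: cvgD.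
    apply: cvgM; first exact: cvg_cst.
    apply: cvgD; first exact: cvg_cst.
    by apply: (cvg_comp _ _ (@cvg_fst _ _ _ _ _)); exact: sqnorm_continuous.
  by apply: cvgV; [rewrite gt_eqF|exact: cvg_snd].
move=> g u _ _ sol x t t0.
have q0 := sqnorm_ge0 x.
have ti0 : 0 < t^-1 by rewrite invr_gt0.
have S0 : 0 <= S x t by rewrite /S; lra.
have /andP[NS SN] := truncn_itv S0.
set N := Num.truncn (S x t) in NS SN.
have NB : 2 * (1 + sqnorm x) + t^-1 < N%:R.
  by move: SN; rewrite -natr1 /S; lra.
apply: le_trans (cC (S x t) N S0 NS).
have N0 : 0 < N%:R :> R by lra.
apply: (CP N g u sol x t).
- by rewrite -(ltr_nat R).
- by rewrite ler_pdivlMr//; nra.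
- by rewrite -[t]invrK lef_pV2 ?posrE//; lra.
Qed.
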